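(* Let $\mathcal C\subseteq\mathbb F_2^n$ be a binary linear code with parity check matrix $H$, minimum distance $d$ and error-correcting capacity $t=\left[\frac{d-1}{2}\right]$. Let $K$ be a field, let $<$ be a total-degree compatible term order on the monomials of $K[x_1,\dots,x_n]$ with $x_1<\dots<x_n$, and let $G_T$ be the reduced Gröbner basis of the ideal $I(\mathcal C)$ with respect to $<$. Let $w\in[X]$ be a monomial. If $\mathrm{weight}(\psi(\mathrm{Can}(w,G_T)))\le t$, then $\psi(\mathrm{Can}(w,G_T))$ is the error vector corresponding to $\psi(w)$, i.e. it is the (unique) vector $e$ of weight at most $t$ with $eH=\psi(w)H$. On the other hand, if $\mathrm{weight}(\psi(\mathrm{Can}(w,G_T)))> t$, then $\psi(w)$ contains more than $t$ errors, i.e. $\psi(w)\notin B(\mathcal C,t)$.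
   Context: A binary linear code $\mathcal C$ of length $n$ is an $\mathbb F_2$-subspace of $\mathbb F_2^n$; a parity check matrix $H$ is a matrix with $cH=0$ iff $c\in\mathcal C$. Weight is Hamming weight; $d$ is the minimum weight of a nonzero codeword; $[\cdot]$ is the integer part. $B(\mathcal C,t)=\{y\in\mathbb F_2^n:\exists c\in\mathcal C,\ d(c,y)\le t\}$; for $y\in B(\mathcal C,t)$ the equation $eH=yH$ has a unique solution $e$ of weight $\le t$, called the error vector of $y$. $[X]$ is the free commutative monoid on $X=\{x_1,\dots,x_n\}$ (the monomials of $K[x_1,\dots,x_n]$), and $\psi:[X]\to\mathbb F_2^n$ is the monoid morphism $\psi(\prod_i x_i^{\beta_i})=(\beta_1\bmod 2,\dots,\beta_n\bmod 2)$. The ideal associated with $\mathcal C$ is $I(\mathcal C)=\langle w-v : w,v\in[X],\ \psi(w)-\psi(v)\in\mathcal C\rangle\subseteq K[x_1,\dots,x_n]$; equivalently it is generated by $\{w_1-1,\dots,w_k-1\}\cup\{x_i^2-1: i=1,\dots,n\}$ where $w_1,\dots,w_k$ are monomials whose images under $\psi$ span $\mathcal C$. $\mathrm{Can}(w,G_T)$ denotes the canonical form (normal form) of $w$ modulo $G_T$. *)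

(* Defs.v *)
From HB Require Import structures.
From Stdlib Require Export Relation_Operators.
From mathcomp Require Export all_boot all_order all_algebra.
From mathcomp Require Export mpoly.

Set Implicit Arguments.
Unset Strict Implicit.
Unset Printing Implicit Defensive.

Import GRing.Theory.
Local Open Scope ring_scope.

Section Codes.
Variable n : nat.
Implicit Types (C : {vspace 'rV['F_2]_n}) (x y e : 'rV['F_2]_n).

Definition weight x : nat := #|[set i | x 0 i != 0]|.

Definition hamming_dist x y : nat := #|[set i | x 0 i != y 0 i]|.

(* Holds for no d when C = 0: the zero code has no minimum distance. *)
Definition is_min_distance C (d : nat) : Prop :=
  (exists c, [/\ c \in C, c != 0 & weight c = d]) /\
  (forall c, c \in C -> c != 0 -> (d <= weight c)%N).

Definition is_parity_check C m (H : 'M['F_2]_(n, m)) : Prop :=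
  forall c, c *m H = 0 <-> c \in C.

Definition in_code_balls C (t : nat) y : Prop :=
  exists2 c, c \in C & (hamming_dist c y <= t)%N.

Definition is_error_vector m (H : 'M['F_2]_(n, m)) (t : nat) y e : Prop :=
  unique (fun e' => (weight e' <= t)%N /\ e' *m H = y *m H) e.

(* The cast of nat into 'F_2 is reduction mod 2. *)
Definition psi (w : 'X_{1..n}) : 'rV['F_2]_n := \row_i (w i)%:R.

End Codes.

Definition ideal_gen (R : comNzRingType) (S : R -> Prop) (p : R) : Prop :=
  exists s : seq (R * R),
    (forall u, u \in s -> S u.2) /\ p = \sum_(u <- s) u.1 * u.2.

Definition code_ideal n (K : fieldType) (C : {vspace 'rV['F_2]_n}) :
    {mpoly K[n]} -> Prop :=
  ideal_gen (fun p : {mpoly K[n]} =>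
    exists w v : 'X_{1..n}, psi w - psi v \in C /\ p = 'X_[w] - 'X_[v]).

(* The exponent 0%MM is the monomial 1, and addition of exponents is the
   product of monomials; (_ <= _)%MM is divisibility of monomials.
   An order is given by its reflexive relation [le]. *)
Section TermOrders.
Variables (n : nat) (le : rel 'X_{1..n}).

Definition mono_lt (m1 m2 : 'X_{1..n}) : bool := (m1 != m2) && le m1 m2.

Definition is_term_order : Prop :=
  [/\ reflexive le, antisymmetric le, transitive le & total le] /\
  (forall m, le 0%MM m) /\
  (forall m m1 m2, le m1 m2 -> le (m1 + m)%MM (m2 + m)%MM).

Definition degree_compatible : Prop :=
  forall m1 m2, (mdeg m1 < mdeg m2)%N -> mono_lt m1 m2.

Definition increasing_vars : Prop :=
  forall i j : 'I_n, (i < j)%N -> mono_lt U_(i)%MM U_(j)%MM.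

Variable K : fieldType.
Implicit Types (G : seq {mpoly K[n]}) (f g h r : {mpoly K[n]}).

(* The leading monomial for [le] (the library's mlead is tied to one fixed
   order); its value on the zero polynomial is irrelevant. *)
Definition lm f : 'X_{1..n} := last 0%MM (sort le (msupp f)).

Definition lc f : K := f@_(lm f).

Definition is_groebner_basis (I : {mpoly K[n]} -> Prop) G : Prop :=
  (forall g, g \in G -> I g /\ g != 0) /\
  (forall f, I f -> f != 0 -> exists2 g, g \in G & (lm g <= lm f)%MM).

Definition is_reduced_groebner_basis (I : {mpoly K[n]} -> Prop) G : Prop :=
  [/\ is_groebner_basis I G,
      forall g, g \in G -> lc g = 1
    & forall g h, g \in G -> h \in G -> h != g ->
        forall m, m \in msupp g -> ~~ (lm h <= m)%MM].

Definition reduces1 G f h : Prop :=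
  exists g m, [/\ g \in G, m \in msupp f, (lm g <= m)%MM
    & h = f - (f@_m / lc g) *: ('X_[m - lm g] * g)].

Definition irreducible_mod G f : Prop :=
  forall g m, g \in G -> m \in msupp f -> ~~ (lm g <= m)%MM.

(* [r] is a normal form of [f] modulo [G]: the outcome of a complete
   multivariate division, all monomials (not only the leading one) being
   reduced. *)
Definition is_normal_form G f r : Prop :=
  clos_refl_trans _ (reduces1 G) f r /\ irreducible_mod G r.

(* For a Groebner basis the normal form is unique: it is Can(f, G). *)
Definition is_canonical_form G f r : Prop := unique (is_normal_form G f) r.

End TermOrders.

(* Main.v *)
(* The ideal is graded by the cosets of C: if f lies in it, the coefficients of
   f over each coset sum to zero, so every monomial of f has a companion in the
   same coset.  Hence the monomials irreducible modulo G are exactly the least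
   elements of their cosets, G consists of binomials inside one coset, and a
   monomial w reduces to the least monomial v of its coset.  As the order is
   degree compatible, psi v has least weight in psi w + C, which is nearest
   codeword decoding. *)
Require Import Defs.
Import GRing.Theory.
Local Open Scope ring_scope.

(** * Closure properties of generated ideals *)

Section IdealGen.
Set Implicit Arguments.
Unset Strict Implicit.
Variables (R : comNzRingType) (S : R -> Prop).

Lemma ideal_gen_sub p : S p -> ideal_gen S p.
Proof.
move=> Sp; exists [:: (1, p)]; split; last by rewrite big_seq1 /= mul1r.
by move=> u; rewrite inE => /eqP->.
Qed.

Lemma ideal_genD p q : ideal_gen S p -> ideal_gen S q -> ideal_gen S (p + q).
Proof.
move=> [s [Ss ->]] [s' [Ss' ->]]; exists (s ++ s'); split; last by rewrite big_cat.
by move=> u; rewrite mem_cat => /orP[/Ss|/Ss'].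
Qed.

Lemma ideal_genMl a p : ideal_gen S p -> ideal_gen S (a * p).
Proof.
move=> [s [Ss ->]]; exists [seq (a * u.1, u.2) | u <- s]; split.
  by move=> u /mapP[u' /Ss Su' ->].
by rewrite big_map mulr_sumr; apply: eq_bigr => u _; rewrite mulrA.
Qed.

Lemma ideal_genB p q : ideal_gen S p -> ideal_gen S q -> ideal_gen S (p - q).
Proof. by move=> Ip Iq; rewrite -mulN1r; apply/ideal_genD/ideal_genMl. Qed.

End IdealGen.

(** * Binary vectors, Hamming weight and the map [psi] *)

Section Binary.
Set Implicit Arguments.
Unset Strict Implicit.
Variable n : nat.
Implicit Types (x y z e : 'rV['F_2]_n) (a b : 'X_{1..n}).

Lemma oppF2 x : - x = x.
Proof.
apply/rowP=> i; rewrite mxE; move: (x 0 i) => c.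
by apply/val_inj; case: c => [[|[|?]] ?].
Qed.

Lemma psiD a b : psi (a + b)%MM = psi a + psi b.
Proof. by apply/rowP=> i; rewrite !mxE mnmDE natrD. Qed.

Lemma hamming_distE x y : hamming_dist x y = weight (x - y).
Proof. by apply: eq_card => i; rewrite !inE !mxE subr_eq0. Qed.

Lemma weightD x y : (weight (x + y) <= weight x + weight y)%N.
Proof.
apply: leq_trans (leq_card_setU _ _); apply/subset_leq_card/subsetP => i.
rewrite !inE !mxE -negb_and; apply: contra => /andP[/eqP-> /eqP->].
by rewrite addr0.
Qed.

Lemma weight_eq0 x : (weight x == 0)%N = (x == 0).
Proof.
rewrite cards_eq0; apply/eqP/eqP => [/setP x0|->]; last first.
  by apply/setP=> i; rewrite !inE mxE eqxx.
by apply/rowP=> i; move: (x0 i); rewrite !inE mxE => /negbFE/eqP.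
Qed.

Lemma weight_psi_le a : (weight (psi a) <= mdeg a)%N.
Proof.
rewrite mdegE /weight -sum1dep_card big_mkcond /=; apply: leq_sum => i _.
by rewrite mxE; case: (a i) => [|k]; rewrite ?eqxx //; case: ifP.
Qed.

(** The preimage of [e] under [psi] of least degree; through it, degree compatibility of the order
    speaks about weights. *)
Definition squarefree_mnm e : 'X_{1..n} :=
  [multinom nat_of_bool (e 0%R i != 0%R) | i < n].

Lemma psi_squarefree e : psi (squarefree_mnm e) = e.
Proof.
apply/rowP=> i; rewrite mxE mnmE; move: (e 0 i) => c.
by apply/val_inj; case: c => [[|[|?]] ?].
Qed.

Lemma mdeg_squarefree e : mdeg (squarefree_mnm e) = weight e.
Proof.
rewrite mdegE /weight -sum1dep_card [RHS]big_mkcond /=; apply: eq_bigr => i _.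
by rewrite mnmE; case: ifP.
Qed.

End Binary.

(** * The code ideal and its grading by cosets *)

Section CodeIdeal.
Set Implicit Arguments.
Unset Strict Implicit.
Variables (n : nat) (K : fieldType) (C : {vspace 'rV['F_2]_n}).
Implicit Types (f g : {mpoly K[n]}) (a b c : 'X_{1..n}).

Definition same_coset a b : bool := psi a - psi b \in C.

Lemma same_coset_refl a : same_coset a a.
Proof. by rewrite /same_coset subrr mem0v. Qed.

Lemma same_coset_sym a b : same_coset a b = same_coset b a.
Proof. by rewrite /same_coset -opprB memvN. Qed.

Lemma same_coset_trans b a c :
  same_coset a b -> same_coset b c -> same_coset a c.
Proof. by move=> ab bc; rewrite /same_coset -(subrKA (psi b)) memvD. Qed.

Lemma same_cosetD c a b : same_coset (c + a)%MM (c + b)%MM = same_coset a b.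
Proof. by rewrite /same_coset !psiD opprD addrACA subrr add0r. Qed.

Lemma code_idealX a b :
  same_coset a b -> code_ideal C ('X_[a] - 'X_[b] : {mpoly K[n]}).
Proof. by move=> ab; apply: ideal_gen_sub; exists a, b. Qed.

(* Truncating at degree k makes additivity in f immediate; the value is the
   full coset sum as soon as k exceeds the degree of f. *)
Definition coset_sum b k f : K :=
  \sum_(m : 'X_{1..n < k} | same_coset m b) f@_m.

Lemma coset_sumX b k a : (mdeg a < k)%N ->
  coset_sum b k 'X_[a] = (same_coset a b)%:R.
Proof.
move=> ak; rewrite /coset_sum; case: (boolP (same_coset a b)) => ab.
  rewrite (bigD1 (BMultinom ak)) //= mcoeffX eqxx big1 ?addr0 // => m /andP[_ ne].
  by rewrite mcoeffX; case: eqP => // e; case/eqP: ne; apply/val_inj.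
rewrite big1 // => m mb; rewrite mcoeffX; case: eqP => // e.
by rewrite e mb in ab.
Qed.

(** A monomial multiple of a generator is a difference of two monomials of one coset, so its coset
    sums vanish. The bound [k0] comes from the terms of the combination, whose degrees may exceed
    that of [f] because of cancellation. *)
Lemma code_ideal_coset_sum f b : code_ideal C f ->
  exists k0, forall k, (k0 <= k)%N -> coset_sum b k f = 0.
Proof.
pose P f := exists k0, forall k, (k0 <= k)%N -> coset_sum b k f = 0.
have P0 : P 0 by exists 0%N => k _; apply: big1 => m _; rewrite mcoeff0.
have PD p q : P p -> P q -> P (p + q).
  move=> [k0 p0] [k1 q0]; exists (maxn k0 k1) => k.
  rewrite geq_max => /andP[h0 h1].
  rewrite /coset_sum (eq_bigr (fun m : 'X_{1..n < k} => p@_m + q@_m)); last first.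
    by move=> m _; rewrite mcoeffD.
  by rewrite big_split /= -/(coset_sum b k p) -/(coset_sum b k q) p0 // q0 // addr0.
move=> [s [Ss ->]]; rewrite big_seq.
apply: (big_ind P) => // -[p q] /Ss /= [a [c [ac ->]]].
rewrite (mpolyE p) mulr_suml; apply: (big_ind P) => // m _.
rewrite -scalerAl mulrBr -!mpolyXD.
exists (maxn (mdeg (m + a)).+1 (mdeg (m + c)).+1) => k.
rewrite geq_max => /andP[h0 h1].
have -> : coset_sum b k (p@_m *: ('X_[m + a] - 'X_[m + c]))
   = p@_m * (coset_sum b k 'X_[m + a] - coset_sum b k 'X_[m + c]).
  rewrite /coset_sum -sumrB mulr_sumr; apply: eq_bigr => u _.
  by rewrite mcoeffZ mcoeffB.
rewrite !coset_sumX //.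
have mac : same_coset (m + a)%MM (m + c)%MM by rewrite same_cosetD.
suff -> : same_coset (m + a)%MM b = same_coset (m + c)%MM b by rewrite subrr mulr0.
apply/idP/idP; last exact: same_coset_trans.
by apply: same_coset_trans; rewrite same_coset_sym.
Qed.

(** Without a companion, the coset sum at [a] would be the single nonzero coefficient of [a]. *)
Lemma code_ideal_partner f a : code_ideal C f -> a \in msupp f ->
  exists b, [/\ b \in msupp f, b != a & same_coset b a].
Proof.
move=> If af; case: (code_ideal_coset_sum a If) => k0 Hk0.
case: (boolP (has (fun b => (b != a) && same_coset b a) (msupp f))).
  by case/hasP=> b bf /andP[ba Cba]; exists b.
move/hasPn=> no.
have ak : (mdeg a < maxn k0 (mdeg a).+1)%N by rewrite leq_max ltnSn orbT.
have := Hk0 _ (leq_maxl k0 (mdeg a).+1).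
rewrite /coset_sum (bigD1 (BMultinom ak)) /= ?same_coset_refl // big1; last first.
  move=> m /andP[ma ne]; apply: memN_msupp_eq0; apply/negP => /no.
  rewrite ma andbT negbK => /eqP e; case/eqP: ne; exact/val_inj.
move/eqP; rewrite addr0 => /eqP fa0.
by move: af; rewrite mcoeff_msupp fa0 eqxx.
Qed.

End CodeIdeal.

(** * Term orders: well-founded induction and leading monomials *)

Section TermOrder.
Set Implicit Arguments.
Unset Strict Implicit.
Variables (n : nat) (le : rel 'X_{1..n}).
Hypothesis le_term : is_term_order le.
Implicit Types (a b c : 'X_{1..n}).

Lemma term_refl : reflexive le. Proof. by case: le_term => -[]. Qed.
Lemma term_anti : antisymmetric le. Proof. by case: le_term => -[]. Qed.
Lemma term_trans : transitive le. Proof. by case: le_term => -[]. Qed.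
Lemma term_total : total le. Proof. by case: le_term => -[]. Qed.

Lemma mono_lt_trans : transitive (mono_lt le).
Proof.
move=> b a c /andP[ab lab] /andP[bc lbc]; apply/andP; split; last exact: term_trans lab lbc.
apply: contraNneq ab => e; rewrite -e in lbc.
by apply/eqP/term_anti; rewrite lab.
Qed.

Lemma mono_ltxx a : mono_lt le a a = false.
Proof. by rewrite /mono_lt eqxx. Qed.

Lemma mono_lt_leF a b : mono_lt le a b -> le b a = false.
Proof.
move=> /andP[ab lab]; apply: contraNF ab => lba.
by apply/eqP/term_anti; rewrite lab.
Qed.

Lemma mono_lt_addl c a b : mono_lt le a b -> mono_lt le (c + a)%MM (c + b)%MM.
Proof.
move=> /andP[ab lab]; rewrite /mono_lt eqm_add2l ab /= ![(c + _)%MM]addmC.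
by case: le_term => _ [_]; apply.
Qed.

(** Predecessors of [a] have degree at most that of [a], so they are finitely many; the induction is
    on their number. *)
Lemma mono_lt_ind (P : 'X_{1..n} -> Prop) : degree_compatible le ->
  (forall a, (forall b, mono_lt le b a -> P b) -> P a) -> forall a, P a.
Proof.
move=> deg_le IH a.
have lt_deg b c : mono_lt le b c -> (mdeg b <= mdeg c)%N.
  move=> bc; rewrite leqNgt; apply/negP.
  by move=> /deg_le/(mono_lt_trans bc); rewrite mono_ltxx.
set k := (mdeg a).+1; have: (mdeg a < k)%N by [].
have [N] := ubnP #|[set b : 'X_{1..n < k} | mono_lt le b a]|.
(* The degree bound [k] stays fixed while [a] descends, so all predecessor sets live in one finite
   type. *)
move: (k) => {}k; elim: N => // N IHN in a * => leN ak.
apply: IH => b ba; have bk : (mdeg b < k)%N by apply: leq_ltn_trans ak; apply: lt_deg.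
apply: IHN => //; rewrite -ltnS; apply: leq_trans leN; rewrite ltnS.
apply/proper_card/properP; split.
  by apply/subsetP=> c; rewrite !inE => /mono_lt_trans; apply.
by exists (BMultinom bk); rewrite !inE /= ?mono_ltxx.
Qed.

Variable K : fieldType.
Implicit Types f : {mpoly K[n]}.

Lemma lm_supp f : f != 0 -> lm le f \in msupp f.
Proof.
rewrite -msupp_eq0 /lm -(mem_sort le) -size_eq0 -(size_sort le) size_eq0.
by case: (sort _ _) => //= a s _; rewrite mem_last.
Qed.

Lemma le_lm f a : a \in msupp f -> le a (lm le f).
Proof.
rewrite /lm -(mem_sort le); have := sort_sorted term_total (msupp f).
case/lastP: (sort _ _) => // s b; rewrite last_rcons -rev_sorted rev_rcons /=.
rewrite (path_sortedE (rev_trans term_trans)) => /andP[/allP sb _].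
rewrite mem_rcons inE => /predU1P[->|as_]; first exact: term_refl.
by apply: sb; rewrite mem_rev.
Qed.

Lemma lt_lm f a : a \in msupp f -> a != lm le f -> mono_lt le a (lm le f).
Proof. by move=> af ne; rewrite /mono_lt ne le_lm. Qed.

End TermOrder.

(** * Irreducible monomials and canonical forms *)

Section Canonical.
Set Implicit Arguments.
Unset Strict Implicit.
Variables (n : nat) (K : fieldType) (C : {vspace 'rV['F_2]_n}).
Variables (le : rel 'X_{1..n}) (G : seq {mpoly K[n]}).
Hypotheses (le_term : is_term_order le) (deg_le : degree_compatible le).
Hypothesis G_red : is_reduced_groebner_basis le (code_ideal C) G.
Implicit Types (f g h r : {mpoly K[n]}) (a b u v w : 'X_{1..n}).

Local Notation I := (@code_ideal n K C).
Local Notation irr := (irreducible_mod le G).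
Local Notation "a ~~C b" := (same_coset C a b) (at level 70).

Lemma basis_ideal g : g \in G -> I g.
Proof. by case: G_red => -[h _] _ _ /h[]. Qed.

Lemma basis_neq0 g : g \in G -> g != 0.
Proof. by case: G_red => -[h _] _ _ /h[]. Qed.

Lemma irreducible_ideal_eq0 f : I f -> irr f -> f = 0.
Proof.
move=> If irrf; apply/eqP; apply: contraT => f0.
case: G_red => -[_ /(_ f If f0)[g gG]] + _ _.
by rewrite (negbTE (irrf _ _ gG (lm_supp le f0))).
Qed.

Lemma irreducible_unique f g : irr f -> irr g -> I (f - g) -> f = g.
Proof.
move=> irrf irrg Ifg; apply/eqP; rewrite -subr_eq0; apply/eqP.
apply: irreducible_ideal_eq0 => // h m hG /msuppB_le.
by rewrite mem_cat => /orP[/irrf|/irrg]; apply.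
Qed.

(** Otherwise ['X_[v] - 'X_[u]] lies in the ideal with leading monomial [v], which some leading
    monomial of [G] must then divide. *)
Lemma irreducibleX_min v u : irr 'X_[v] -> u ~~C v -> le v u.
Proof.
move=> irrv uv; case: (boolP (le v u)) => // Nvu; exfalso.
have luv : le u v.
  by case/orP: (term_total le_term v u) => // vu; rewrite vu in Nvu.
have nuv : u != v by apply: contraNneq Nvu => ->; apply: term_refl.
pose f : {mpoly K[n]} := 'X_[v] - 'X_[u].
have fv : v \in msupp f.
  by rewrite mcoeff_msupp mcoeffB !mcoeffX eqxx (negbTE nuv) subr0 oner_neq0.
have f0 : f != 0 by apply: contraTneq fv => ->; rewrite msupp0.
have lmf : lm le f = v.
  have := le_lm le_term fv; have := msuppB_le (lm_supp le f0).
  rewrite mem_cat !msuppX !inE => /orP[/eqP//|/eqP->].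
  by rewrite (negbTE Nvu).
have If : I f by apply: code_idealX; rewrite same_coset_sym.
case: G_red => -[_ /(_ f If f0)[g gG]] + _ _; rewrite lmf.
by apply/negP/irrv => //; rewrite msuppX inE.
Qed.

Lemma irreducibleXP w :
  irr 'X_[w] \/ exists2 g, g \in G & (lm le g <= w)%MM.
Proof.
case: (boolP (has (fun g => (lm le g <= w)%MM) G)) => [/hasP|/hasPn] h; first by right.
by left=> g m gG; rewrite msuppX inE => /eqP->; apply: h.
Qed.

(** The factor [lm le g] of [w] is replaced by a smaller companion from the support of [g]. This
    descends within the coset but need not be a reduction step, as [g] is not yet known to be a
    binomial. *)
Lemma exists_irreducibleX w : exists2 u, irr 'X_[u] & u ~~C w.
Proof.
move: w; apply: (mono_lt_ind le_term deg_le) => w IH.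
case: (irreducibleXP w) => [irrw|[g gG gw]]; first by exists w; rewrite ?same_coset_refl.
have [b [bg bne bC]] := code_ideal_partner (basis_ideal gG)
  (lm_supp le (basis_neq0 gG)).
have := mono_lt_addl le_term (w - lm le g)%MM (lt_lm le_term bg bne).
rewrite submK // => /IH[u irru uC]; exists u => //.
by apply: same_coset_trans uC _; rewrite -{2}(submK gw) same_cosetD.
Qed.

(* By reducedness the tail of g is irreducible, and so is some monomial
   in the coset of lm g; both are normal forms of lm g. *)
Lemma basis_binomial g : g \in G ->
  exists2 u, g = 'X_[lm le g] - 'X_[u] & u ~~C lm le g.
Proof.
move=> gG; have [u irru uC] := exists_irreducibleX (lm le g); exists u => //.
suff : 'X_[lm le g] - g = 'X_[u] by move=> <-; rewrite subKr.
apply: irreducible_unique => //; last first.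
  rewrite addrAC; apply: ideal_genB (basis_ideal gG).
  by apply: code_idealX; rewrite same_coset_sym.
case: G_red => _ lc1 tail h m hG m_supp.
have mne : m != lm le g.
  apply: contraTneq m_supp => ->; rewrite mcoeff_msupp mcoeffB mcoeffX eqxx.
  by have := lc1 g gG; rewrite /lc => ->; rewrite subrr eqxx.
have mg : m \in msupp g.
  have := msuppB_le m_supp.
  by rewrite mem_cat msuppX inE (negbTE mne).
case: (eqVneq h g) => [->|hg]; last exact: tail gG hG hg m mg.
(* Reducedness compares distinct elements only; for [g] itself, a multiple of its leading monomial
   cannot lie below that monomial. *)
apply/negP => gm; have := lt_lm le_term mg mne.
case/(mono_lt_leF le_term)/negP; case: le_term => _ [le0 leD].
by have := leD (lm le g) _ _ (le0 (m - lm le g)%MM); rewrite add0m submK.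
Qed.

(** Since [G] consists of binomials, a reduction step can turn a monomial into a smaller monomial of
    the same coset. *)
Lemma reduces_irreducibleX w :
  exists v, [/\ clos_refl_trans _ (reduces1 le G) 'X_[w] 'X_[v],
    irr 'X_[v] & v ~~C w].
Proof.
move: w; apply: (mono_lt_ind le_term deg_le) => w IH.
case: (irreducibleXP w) => [irrw|[g gG gw]].
  by exists w; rewrite same_coset_refl; split=> //; apply: rt_refl.
have [u gE uC] := basis_binomial gG.
pose w' := (w - lm le g + u)%MM.
have w'C : w' ~~C w by rewrite /w' -{2}(submK gw) same_cosetD.
have step : reduces1 le G 'X_[w] 'X_[w'].
  exists g, w; split=> //; first by rewrite msuppX inE.
  case: G_red => _ /(_ g gG)-> _; rewrite mcoeffX eqxx divr1 scale1r.
  by rewrite {2}gE mulrBr -!mpolyXD submK // subKr.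
have lt_u : mono_lt le u (lm le g).
  have gu : u != lm le g.
    by apply: contraNneq (basis_neq0 gG) => e; rewrite gE e subrr.
  apply: lt_lm => //; rewrite gE mcoeff_msupp mcoeffB !mcoeffX eqxx.
  by rewrite [_ == u]eq_sym (negbTE gu) sub0r oppr_eq0 oner_eq0.
have /IH[v [red irrv vC]] : mono_lt le w' w.
  by have := mono_lt_addl le_term (w - lm le g)%MM lt_u; rewrite submK.
exists v; split=> //; last exact: same_coset_trans w'C.
exact: rt_trans (rt_step _ _ _ _ step) red.
Qed.

Lemma reduces_ideal f r : clos_refl_trans _ (reduces1 le G) f r -> I (f - r).
Proof.
elim=> [p q [g [m [gG _ _ ->]]]|p|p q s _ Ipq _ Iqs].
- rewrite subKr scalerAl; exact: ideal_genMl (basis_ideal gG).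
- by rewrite subrr -(mul0r 0); exists [::]; rewrite big_nil mul0r.
- by rewrite -(subrKA q); apply: ideal_genD.
Qed.

Lemma canonical_formX w :
  exists v, [/\ is_canonical_form le G 'X_[w] 'X_[v], irr 'X_[v] & v ~~C w].
Proof.
have [v [red irrv vC]] := reduces_irreducibleX w; exists v; split=> //.
split=> // r [red' irrr]; apply: irreducible_unique => //.
rewrite -(subrKA 'X_[w]); apply: ideal_genD (reduces_ideal red').
exact: code_idealX.
Qed.

(** The weight of [psi v] is at most the degree of [v], which by minimality in the coset is at most
    the degree of [squarefree_mnm y], that is, the weight of [y]. *)
Lemma irreducibleX_weight_min v y : irr 'X_[v] -> psi v - y \in C ->
  (weight (psi v) <= weight y)%N.
Proof.
move=> irrv vy; apply: leq_trans (weight_psi_le v) _.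
rewrite leqNgt -mdeg_squarefree; apply/negP => /deg_le/(mono_lt_leF le_term).
by rewrite irreducibleX_min // same_coset_sym /same_coset psi_squarefree.
Qed.

End Canonical.

(** * Unique decoding and the theorem *)

Lemma error_vector_unique (n : nat) (C : {vspace 'rV['F_2]_n}) (d : nat)
    (x y : 'rV['F_2]_n) :
  is_min_distance C d -> (weight x <= (d - 1) %/ 2)%N ->
  (weight y <= (d - 1) %/ 2)%N -> x - y \in C -> x = y.
Proof.
move=> [[c [_ c0 cd]] dmin] xt yt xyC; apply/eqP; rewrite -subr_eq0.
apply: contraT => /(dmin _ xyC) dle.
(* Truncated subtraction gives [d - 1 < d] only for positive [d]; this is what contradicts a nonzero
   codeword [x - y] of weight at most [d - 1]. *)
have d0 : (0 < d)%N by rewrite -cd lt0n weight_eq0.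
have := leq_trans dle (leq_trans (weightD _ _) (leq_add xt _)).
rewrite oppF2 => /(_ _ yt); rewrite addnn -muln2 => dle'.
have := leq_trans dle' (leq_divM _ _).
by rewrite leqNgt subn1 prednK ?leqnn.
Qed.

Theorem theorem1 (n : nat) (C : {vspace 'rV['F_2]_n})
    (m : nat) (H : 'M['F_2]_(n, m)) (d t : nat) (K : fieldType)
    (le : rel 'X_{1..n}) (G : seq {mpoly K[n]}) (w : 'X_{1..n}) :
  is_parity_check C H ->
  is_min_distance C d ->
  t = ((d - 1) %/ 2)%N ->
  is_term_order le ->
  degree_compatible le ->
  increasing_vars le ->
  is_reduced_groebner_basis le (code_ideal C) G ->
  (* Can(w, G) is the monomial 'X_[v] *)
  exists v : 'X_{1..n},
    is_canonical_form le G 'X_[w] 'X_[v] /\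
    ((weight (psi v) <= t)%N -> is_error_vector H t (psi w) (psi v)) /\
    ((t < weight (psi v))%N -> ~ in_code_balls C t (psi w)).
Proof.
move=> HC dC -> le_term deg_le _ G_red.
have [v [can irrv vw]] := canonical_formX le_term deg_le G_red w.
have syndrome x y : x *m H = y *m H <-> x - y \in C.
  rewrite -HC mulmxBl; split=> [->|/eqP]; first by rewrite subrr.
  by rewrite subr_eq0 => /eqP.
exists v; split=> //; split=> [vt|tv [c cC ct]].
  split; first by split=> //; apply/syndrome.
  move=> e [et eH]; apply: error_vector_unique dC vt et _.
  by apply/syndrome; rewrite eH; apply/syndrome.
move: tv; rewrite ltnNge => /negP; apply; apply: leq_trans ct.
(* In characteristic 2 the sign of [psi w] is immaterial, so [c - psi w] lies in the coset of
   [psi v] and weighs at least as much. *)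
rewrite hamming_distE; apply: (irreducibleX_weight_min le_term deg_le G_red irrv).
by rewrite opprB -[X in _ + (X - c)]oppF2 addrA memvB.
Qed.
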